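(* Let $f \in \mathbb{C}[Z]$ be a psd-stable polynomial on the space of complex symmetric $n\times n$ matrices and let $W$ be a real symmetric positive definite $n \times n$ matrix. Then the initial form $\mathrm{in}_W(f)$ is psd-stable.
   Context: $\mathbb{C}[Z]$ denotes the ring of polynomials in the entries $z_{ij}$ of a symmetric $n\times n$ variable matrix $Z=(z_{ij})$, with $z_{ij}$ and $z_{ji}$ identified. Monomials are written $Z^\alpha=\prod_{1\le i,j\le n} z_{ij}^{\alpha_{ij}}$, where $\alpha$ is a symmetric matrix with non-negative entries, whose diagonal entries are integers and whose off-diagonal entries are half-integers (elements of $\frac12\mathbb{Z}$); thus for $i<j$ the variable $z_{ij}$ occurs in $Z^\alpha$ with exponent $2\alpha_{ij}$. A polynomial $f\in\mathbb{C}[Z]$ is psd-stable if $f(M)\ne 0$ for every complex symmetric $n\times n$ matrix $M$ whose entrywise imaginary part $\mathrm{Im}(M)$ is positive definite. For $f=\sum_{\alpha\in S} c_\alpha Z^\alpha$ with support $S$ (all $c_\alpha\neq 0$) and a real symmetric matrix $W$, the initial form is $\mathrm{in}_W(f)=\sum_{\alpha\in S_W} c_\alpha Z^\alpha$, where $S_W=\{\alpha\in S : \langle W,\alpha\rangle_F=\max_{\beta\in S}\langle W,\beta\rangle_F\}$ and $\langle W,\alpha\rangle_F=\sum_{i,j} w_{ij}\alpha_{ij}$ is the Frobenius product. *)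

(* Defs.v *)
From HB Require Import structures.
From mathcomp Require Import all_boot all_order all_algebra.
From mathcomp Require Import reals complex.
From mathcomp Require Import mpoly.

Set Implicit Arguments.
Unset Strict Implicit.
Unset Printing Implicit Defensive.

Import Order.TTheory GRing.Theory Num.Theory.
Local Open Scope ring_scope.

(* The entries of a symmetric variable matrix, z_ij and z_ji being identified:
   one variable for each pair i <= j. *)
Definition symvar (n : nat) : finType :=
  {p : 'I_n * 'I_n | (p.1 <= p.2)%N}.

Lemma symvar_subproof (n : nat) (i j : 'I_n) :
  let p := if (i <= j)%N then (i, j) else (j, i) in (p.1 <= p.2)%N.
Proof. by case: (leqP i j) => [//|/ltnW]. Qed.

(* The variable z_ij = z_ji, numbered as required by {mpoly _[_]}. *)
Definition zidx (n : nat) (i j : 'I_n) : 'I_#|symvar n| :=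
  enum_rank (Sub (if (i <= j)%N then (i, j) else (j, i))
                 (symvar_subproof i j) : symvar n).

Definition sympoly (R : realType) (n : nat) := {mpoly R[i][#|symvar n|]}.

Definition sympoint (T : Type) (n : nat) (M : 'M[T]_n) (k : 'I_#|symvar n|) : T :=
  let p := val (enum_val k) in M p.1 p.2.

Definition sympoly_eval (R : realType) (n : nat)
  (f : sympoly R n) (M : 'M[R[i]]_n) : R[i] := f.@[sympoint M].

Definition posdefmx (R : realType) (n : nat) (A : 'M[R]_n) : Prop :=
  A^T = A /\ forall x : 'cV[R]_n, x != 0 -> 0 < (x^T *m A *m x) 0 0.

Definition psd_stable (R : realType) (n : nat) (f : sympoly R n) : Prop :=
  forall M : 'M[R[i]]_n,
    M^T = M -> posdefmx (map_mx (@complex.Im R) M) -> sympoly_eval f M != 0.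

(* The symmetric matrix alpha with Z^alpha = 'X_[m]: for i != j the exponent of
   z_ij is shared equally between alpha_ij and alpha_ji. *)
Definition expmx (R : realType) (n : nat) (m : 'X_{1..#|symvar n|}) : 'M[R]_n :=
  \matrix_(i, j) (if i == j then (m (zidx i j))%:R else (m (zidx i j))%:R / 2).

Definition frobenius (R : realType) (n : nat) (A B : 'M[R]_n) : R :=
  \sum_i \sum_j A i j * B i j.

Definition max_weight (R : realType) (n : nat) (W : 'M[R]_n) (f : sympoly R n)
  (m : 'X_{1..#|symvar n|}) : bool :=
  all (fun b => frobenius W (expmx R b) <= frobenius W (expmx R m)) (msupp f).

Definition initial_form (R : realType) (n : nat) (W : 'M[R]_n)
  (f : sympoly R n) : sympoly R n :=
  \sum_(m <- msupp f | max_weight W f m) f@_m *: 'X_[m].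

Lemma zidxC (n : nat) (i j : 'I_n) : zidx i j = zidx j i.
Proof.
congr enum_rank; apply: val_inj => /=.
by case: (ltngtP i j) => // /val_inj ->.
Qed.

Lemma sympoint_zidx (T : Type) (n : nat) (M : 'M[T]_n) (i j : 'I_n) :
  M^T = M -> sympoint M (zidx i j) = M i j.
Proof.
move=> sM; rewrite /sympoint /zidx enum_rankK /=.
by case: leqP => //= _; rewrite -[in LHS]sM mxE.
Qed.

(* Main.v *)
(* For t > 0 put M_t = (exp (t w_ij) M_ij).  If <W, alpha> is maximal equal to
   omega on the support of f, then exp (- t omega) f(M_t) differs from in_W(f)(M)
   by O(1/t).  By the Schur product theorem, applied to each term of the
   exponential series, Im M_t is positive definite as soon as Im M is, so that
   M |-> f(M_t) is psd-stable for every t > 0.  Were in_W(f)(M) = 0 for some M in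
   the open domain where Im M > 0, consider the polynomials
   s |-> exp (- t omega) f((M + s D)_t), of bounded degree: they have no root in a
   disc |s| < e independent of t, which bounds their growth from s = 0 to s = 1
   by a constant factor.  Letting t tend to infinity gives in_W(f)(M + D) = 0
   for every symmetric D, so in_W(f) = 0, which is absurd. *)
Require Import Defs.
From HB Require Import structures.
From mathcomp Require Import all_boot all_order all_algebra.
From mathcomp Require Import reals complex.
From mathcomp Require Import mpoly ring lra zify.
From mathcomp Require classical_sets filter topology normedtype sequences exp.

Set Implicit Arguments.
Unset Strict Implicit.
Unset Printing Implicit Defensive.

Import Order.TTheory GRing.Theory Num.Theory.
Import sequences exp.
Local Open Scope ring_scope.
Local Notation "x %:C" := (real_complex _ x).

(** * Semidefinite forms and the Schur product *)

Section BilinearForms.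
Variables (F : realFieldType) (I : finType).
Implicit Types (A B : I -> I -> F) (x y z : I -> F).

Definition bform A x y : F := \sum_i \sum_j A i j * (x i * y j).

Definition semidefinite A : Prop :=
  (forall i j, A i j = A j i) /\ forall x, 0 <= bform A x x.

Lemma eq_bform A B x y : A =2 B -> bform A x y = bform B x y.
Proof. by move=> eqAB; do 2!apply: eq_bigr => ? _; rewrite eqAB. Qed.

Lemma bformC A x y : (forall i j, A i j = A j i) -> bform A x y = bform A y x.
Proof.
move=> sA; rewrite /bform exchange_big /=; do 2!apply: eq_bigr => ? _.
by rewrite sA [x _ * _]mulrC.
Qed.

Lemma bformDr A a b x y z :
  bform A z (fun i => a * x i + b * y i) = a * bform A z x + b * bform A z y.
Proof.
rewrite /bform !mulr_sumr -big_split; apply: eq_bigr => i _ /=.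
rewrite !mulr_sumr -big_split; apply: eq_bigr => j _ /=; ring.
Qed.

Lemma bform_sqrD A a b x y : (forall i j, A i j = A j i) ->
  bform A (fun i => a * x i + b * y i) (fun i => a * x i + b * y i) =
  a ^+ 2 * bform A x x + 2 * a * b * bform A x y + b ^+ 2 * bform A y y.
Proof.
move=> sA; set u := fun i => _.
have uE z : bform A z u = a * bform A z x + b * bform A z y by exact: bformDr.
clearbody u; rewrite uE (bformC u x sA) (bformC u y sA) !uE (bformC y x sA).
ring.
Qed.

Lemma bform_cauchy_schwarz A x y : semidefinite A ->
  bform A x y ^+ 2 <= bform A x x * bform A y y.
Proof.
move=> [sA pA].
have [xx0|] := ltrP 0 (bform A x x); last first.
  rewrite le_eqVlt ltNge pA orbF => /eqP xx0; rewrite xx0 mul0r.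
  have [-> | xy0] := eqVneq (bform A x y) 0; first by rewrite expr0n.
  (* For isotropic [x] the form is affine in [t] along t x + y; this [t] gives it the value -1. *)
  pose t := - (bform A y y + 1) / (2 * bform A x y).
  have := pA (fun i => t * x i + 1 * y i); rewrite bform_sqrD // xx0.
  suff -> : t ^+ 2 * 0 + 2 * t * 1 * bform A x y + 1 ^+ 2 * bform A y y = - 1.
    by rewrite oppr_ge0 ler10.
  by rewrite /t; field.
(* At this vector the form equals A(x,x) (A(x,x) A(y,y) - A(x,y)^2). *)
have := pA (fun i => - bform A x y * x i + bform A x x * y i).
rewrite bform_sqrD // => h; rewrite -subr_ge0 -(pmulr_rge0 _ xx0).
by apply: le_trans h _; rewrite le_eqVlt; apply/orP; left; apply/eqP; ring.
Qed.

Lemma bform_deltal A p x :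
  bform A (fun i => (i == p)%:R) x = \sum_j A p j * x j.
Proof.
rewrite /bform (bigD1 p) //= [X in _ + X]big1 ?addr0 => [|i /negbTE ip].
  by apply: eq_bigr => j _; rewrite eqxx mul1r.
by rewrite ip big1 // => j _; rewrite mul0r mulr0.
Qed.

Lemma bform_delta A p q :
  bform A (fun i => (i == p)%:R) (fun i => (i == q)%:R) = A p q.
Proof.
rewrite bform_deltal (bigD1 q) //= eqxx mulr1 big1 ?addr0 // => j /negbTE ->.
by rewrite mulr0.
Qed.

Lemma semidefinite_diag_ge0 A p : semidefinite A -> 0 <= A p p.
Proof. by case=> _ /(_ (fun i => (i == p)%:R)); rewrite bform_delta. Qed.

Lemma semidefinite_row_diag0 A p q : semidefinite A -> A p p = 0 -> A p q = 0.
Proof.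
move=> sdA App.
have := bform_cauchy_schwarz (fun i => (i == p)%:R) (fun i => (i == q)%:R) sdA.
rewrite !bform_delta App mul0r => h; apply/eqP.
by rewrite -sqrf_eq0 eq_le h sqr_ge0.
Qed.

(** One step of symmetric Gaussian elimination: the Schur complement of the entry at [p], kept at
    full size. If [A p p = 0], the quotient is 0 by convention and [A] is unchanged. *)
Definition pivot A p i j := A i j - A i p * A p j / A p p.

(** The new form at x is A(x,x) - A(e_p,x)^2 / A_pp, which Cauchy-Schwarz makes nonnegative. *)
Lemma semidefinite_pivot A p : semidefinite A -> semidefinite (pivot A p).
Proof.
move=> sdA; have [sA pA] := sdA; split=> [i j|x].
  by rewrite /pivot [A i j]sA [A i p]sA [A p j]sA [A p i * _]mulrC.
have -> : bform (pivot A p) x x =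
    bform A x x - bform A (fun i => (i == p)%:R) x ^+ 2 / A p p.
  rewrite bform_deltal expr2 big_distrl mulr_suml /bform -sumrB.
  apply: eq_bigr => i _; rewrite /= mulr_sumr mulr_suml -sumrB.
  by apply: eq_bigr => j _; rewrite /pivot [A i p]sA; ring.
rewrite subr_ge0; have := semidefinite_diag_ge0 p sdA.
rewrite le_eqVlt => /predU1P[<- | App]; first by rewrite invr0 mulr0.
rewrite ler_pdivrMr // mulrC.
have := bform_cauchy_schwarz (fun i => (i == p)%:R) x sdA.
by rewrite bform_delta.
Qed.

(* Subtracting the rank-one matrix of a nonzero pivot clears that pivot's row;
   what is subtracted acts on the second factor as a congruence by a diagonal
   matrix. *)
Lemma schur_product A B : semidefinite A -> semidefinite B ->
  semidefinite (fun i j => A i j * B i j).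
Proof.
move=> sdA sdB; have [sB pB] := sdB.
(* Induction on the number of nonzero diagonal entries; if there are none, [A] vanishes by
   [semidefinite_row_diag0]. *)
have [m] := ubnP #|[set i | A i i != 0]|.
elim: m A sdA => // m IHm A sdA; rewrite ltnS => leAm; have [sA _] := sdA.
split=> [i j|x]; first by rewrite sA sB.
have [/existsP[p App] | /existsPn diag0] := boolP [exists p, A p p != 0]; last first.
  rewrite /bform big1 // => i _; rewrite big1 // => j _.
  rewrite (semidefinite_row_diag0 _ sdA) ?mul0r //.
  by apply/eqP; rewrite -[_ == _]negbK.
have sdA' := semidefinite_pivot p sdA.
have lt_supp : (#|[set i | pivot A p i i != 0%R]| < m)%N.
  apply: leq_trans leAm; apply: proper_card; apply/properP; split.
    (* Where [A i i = 0], the pivoted diagonal entry is both nonnegative and at most 0, so no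
       nonzero entry appears; the one at [p] is lost. *)
    apply/subsetP => i; rewrite !inE; apply: contraNneq => Aii.
    rewrite eq_le (semidefinite_diag_ge0 i sdA') andbT.
    rewrite /pivot Aii sub0r oppr_le0 [A i p]sA -expr2.
    by rewrite mulr_ge0 ?sqr_ge0 ?invr_ge0 ?semidefinite_diag_ge0.
  by exists p; rewrite !inE // /pivot mulfK // subrr eqxx.
have [_ /(_ x) ge0] := IHm _ sdA' lt_supp.
have -> : bform (fun i j => A i j * B i j) x x =
    bform (fun i j => pivot A p i j * B i j) x x +
    (A p p)^-1 * bform B (fun i => A p i * x i) (fun i => A p i * x i).
  rewrite /bform mulr_sumr -big_split; apply: eq_bigr => i _ /=.
  rewrite mulr_sumr -big_split; apply: eq_bigr => j _ /=.
  by rewrite /pivot [A i p]sA; ring.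
by rewrite addr_ge0 // mulr_ge0 // invr_ge0 semidefinite_diag_ge0.
Qed.

Lemma schur_power A B k : semidefinite A -> semidefinite B ->
  semidefinite (fun i j => A i j ^+ k * B i j).
Proof.
move=> sdA sdB; elim: k => [|k [sk pk]].
  have [sB pB] := sdB; split=> [i j|x]; first by rewrite !expr0 sB.
  by under eq_bform => i j do rewrite expr0 mul1r.
have [s p] := schur_product sdA (conj sk pk).
split=> [i j|x]; first by rewrite !exprS -!mulrA s.
by under eq_bform => i j do rewrite exprS -mulrA.
Qed.

End BilinearForms.

(** * Positive definite matrices *)

Lemma qformE (R : realType) n (A : 'M[R]_n) (u v : 'cV[R]_n) :
  (u^T *m A *m v) 0 0 = bform A (u^~ 0) (v^~ 0).
Proof.
rewrite mxE /bform exchange_big; apply: eq_bigr => j _.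
rewrite mxE mulr_suml; apply: eq_bigr => i _; rewrite mxE; ring.
Qed.

Lemma posdefmxP (R : realType) n (A : 'M[R]_n) : posdefmx A <->
  (forall i j, A i j = A j i) /\
  forall x : 'I_n -> R, (exists i, x i != 0) -> 0 < bform A x x.
Proof.
split=> [[sA pA] | [sA pA]]; split.
- by move=> i j; rewrite -[in LHS]sA mxE.
- move=> x [i xi]; have := pA (\col_i x i); rewrite qformE.
  have -> : bform A ((\col_i x i)^~ 0) ((\col_i x i)^~ 0) = bform A x x.
    by do 2!apply: eq_bigr => ? _; rewrite !mxE.
  by apply; apply: contraNneq xi => /matrixP/(_ i 0); rewrite !mxE => ->.
- by apply/matrixP => i j; rewrite mxE.
move=> u u0; rewrite qformE; apply: pA; apply/existsP; apply: contraNT u0.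
rewrite negb_exists => /forallP u0; apply/eqP/matrixP => i j.
by rewrite ord1 mxE; apply/eqP; rewrite -[_ == _]negbK u0.
Qed.

Lemma posdefmx_semidefinite (R : realType) n (A : 'M[R]_n) :
  posdefmx A -> semidefinite A.
Proof.
move=> /posdefmxP[sA pA]; split=> // x.
have [/existsP/pA/ltW // | /existsPn x0] := boolP [exists i, x i != 0].
rewrite /bform big1 // => i _; rewrite big1 // => j _.
by have /eqP -> := negPn (x0 i); rewrite mul0r mulr0.
Qed.

Lemma semidefiniteZ (R : realType) n (A : 'M[R]_n) a :
  0 <= a -> semidefinite A -> semidefinite (a *: A).
Proof.
move=> a0 [sA pA]; split=> [i j|x]; first by rewrite !mxE sA.
have -> : bform (a *: A) x x = a * bform A x x.
  rewrite /bform mulr_sumr; apply: eq_bigr => i _; rewrite mulr_sumr.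
  by apply: eq_bigr => j _; rewrite mxE -mulrA.
exact: mulr_ge0.
Qed.

(** Each coordinate is a pairing x_i = A(u_i, x), with u_i the i-th column of the inverse of [A], so
    Cauchy-Schwarz bounds it. *)
Lemma posdefmx_coord_bound (R : realType) n (A : 'M[R]_n) : posdefmx A ->
  exists2 C, 0 <= C & forall x i, x i ^+ 2 <= C * bform A x x.
Proof.
move=> pdA; have [sA pA] := pdA; have sdA := posdefmx_semidefinite pdA.
have uA : A \in unitmx.
  rewrite -row_free_unit; apply/inj_row_free => v vA.
  apply: contraTeq isT => v0; have := pA v^T; rewrite trmxK vA mul0mx mxE ltxx.
  by apply; rewrite -trmx0 (inj_eq trmx_inj).
pose u i : 'I_n -> R := invmx A ^~ i.
have uE i x : bform A (u i) x = x i.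
  have <- : bform A x (u i) = bform A (u i) x by apply: bformC; case: sdA.
  transitivity (\sum_k x k * (A *m invmx A) k i).
    apply: eq_bigr => k _; rewrite mxE mulr_sumr; apply: eq_bigr => l _.
    by rewrite /u; ring.
  rewrite mulmxV // (bigD1 i) //= mxE eqxx mulr1 big1 ?addr0 // => k /negbTE ki.
  by rewrite mxE ki mulr0.
have u_ge0 i : 0 <= bform A (u i) (u i) by case: sdA.
exists (\sum_i bform A (u i) (u i)) => [|x i]; first exact: sumr_ge0.
rewrite -[x i]uE; apply: le_trans (bform_cauchy_schwarz _ _ sdA) _.
apply: ler_wpM2r; first by case: sdA.
by rewrite (bigD1 i) //= lerDl sumr_ge0.
Qed.

(** There are two directions because a complex step z D moves Im M along both Im D and Re D. *)
Lemma posdefmx_open (R : realType) n (A B C : 'M[R]_n) :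
  posdefmx A -> B^T = B -> C^T = C ->
  exists2 e, 0 < e & forall a b, `|a| < e -> `|b| < e ->
    posdefmx (A + a *: B + b *: C).
Proof.
move=> pdA sB sC; have [K K0 xK] := posdefmx_coord_bound pdA.
pose L := K * \sum_i \sum_j (`|B i j| + `|C i j|).
have L0 : 0 <= L.
  rewrite mulr_ge0 // !sumr_ge0 // => i _; rewrite sumr_ge0 // => j _.
  by rewrite addr_ge0.
(* Taking [1 + L] rather than [L] covers [L = 0] and gives L / (1 + L) < 1, which makes the final
   bound strict. *)
exists (1 + L)^-1 => [|a b lta ltb]; first by rewrite invr_gt0 ltr_pwDl.
have [/posdefmxP[sA pA]] := (pdA, posdefmx_semidefinite pdA); case=> _ psA.
apply/posdefmxP; split=> [i j|x nzx].
  by rewrite !mxE sA -[in LHS]sB -[in LHS]sC !mxE.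
have px := pA x nzx.
have -> : bform (A + a *: B + b *: C) x x = bform A x x +
    \sum_i \sum_j (a * B i j + b * C i j) * (x i * x j).
  rewrite /bform -big_split; apply: eq_bigr => i _; rewrite -big_split.
  by apply: eq_bigr => j _; rewrite !mxE /=; ring.
have xx i j : `|x i * x j| <= K * bform A x x.
  rewrite normrM; have := xK x i; have := xK x j.
  rewrite -(real_normK (num_real (x i))) -(real_normK (num_real (x j))).
  have := sqr_ge0 (`|x i| - `|x j|).
  have := normr_ge0 (x i); have := normr_ge0 (x j).
  move: `|x i| `|x j| (K * _) => p q r; nra.
rewrite -ltrBlDl sub0r ltrNl.
apply: le_lt_trans (ler_norm _) _; rewrite normrN.
apply: (@le_lt_trans _ _ ((1 + L)^-1 * L * bform A x x)); last first.
  by rewrite gtr_pMl // mulrC ltr_pdivrMr ?mul1r ?ltr_pwDl // ltrDr.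
have -> : (1 + L)^-1 * L * bform A x x =
  \sum_i \sum_j ((1 + L)^-1 * (`|B i j| + `|C i j|)) * (K * bform A x x).
  under eq_bigr => i _ do rewrite -mulr_suml -mulr_sumr.
  by rewrite -mulr_suml -mulr_sumr /L; ring.
apply: le_trans (ler_norm_sum _ _ _) _; apply: ler_sum => i _.
apply: le_trans (ler_norm_sum _ _ _) _; apply: ler_sum => j _.
rewrite normrM ler_pM // (le_trans (ler_normD _ _)) // !normrM mulrDr.
by rewrite lerD // ler_wpM2r // ltW.
Qed.

(** * Entrywise exponentials *)

Section ExpSeries.
Import classical_sets filter topology normedtype.
Import numFieldNormedType.Exports.
Local Open Scope classical_set_scope.

(** The left side is the term k = 0 of the exponential series of the right side; the other terms are
    nonnegative, and the inequality passes from partial sums to the limit. *)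
Lemma expR_sum_ge (R : realType) (I : finType) (w a : I -> R) :
  (forall k, 0 <= \sum_i w i ^+ k * a i) ->
  \sum_i a i <= \sum_i expR (w i) * a i.
Proof.
move=> pos.
pose u N := \sum_i series (exp_coeff (w i)) N * a i.
have uE N : u N = \sum_(k < N) (k`!%:R)^-1 * \sum_i w i ^+ k * a i.
  rewrite /u; under eq_bigr => i _ do rewrite /series /= big_mkord big_distrl.
  rewrite exchange_big /=; apply: eq_bigr => k _; rewrite big_distrr /=.
  by apply: eq_bigr => i _; rewrite mulrAC mulrC.
have uge N : \sum_i a i <= u N.+1.
  rewrite uE big_ord_recl /= fact0 invr1 mul1r.
  under [in leRHS]eq_bigr => i _ do rewrite expr0 mul1r.
  by rewrite lerDl sumr_ge0 // => k _; rewrite mulr_ge0 ?invr_ge0 ?ler0n.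
have ucvg : (fun N => u N) @ \oo --> \sum_i expR (w i) * a i.
  rewrite /u; apply: cvg_big => [|i _]; first exact: add_continuous.
  apply: cvgMr_tmp.
  exact: is_cvg_series_exp_coeff.
rewrite -(cvg_lim _ ucvg) //; apply: limr_ge.
  by apply/cvg_ex; eexists; exact: ucvg.
by exists 1%N => // -[|N].
Qed.
End ExpSeries.

(** Strictness comes from the term k = 0, the form of [B] itself; the higher terms only have to be
    semidefinite, by [schur_power]. *)
Lemma posdefmx_expR (R : realType) n (A B : 'M[R]_n) :
  semidefinite A -> posdefmx B ->
  posdefmx (\matrix_(i, j) (expR (A i j) * B i j)).
Proof.
move=> sdA pdB; have [/posdefmxP[sB pB] sdB] := (pdB, posdefmx_semidefinite pdB).
have [sA _] := sdA; apply/posdefmxP; split=> [i j|x /pB x_gt0].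
  by rewrite !mxE sA sB.
apply: lt_le_trans x_gt0 _.
rewrite /bform !pair_big /=.
under [leRHS]eq_bigr => p _ do rewrite mxE -mulrA.
apply: expR_sum_ge => k; have [_ /(_ x)] := schur_power k sdA sdB.
by rewrite /bform pair_big /=; under eq_bigr => p _ do rewrite -mulrA.
Qed.

(** * Limits of exponential sums of polynomials *)

(** Every root r has |r| >= e, so |z - r| <= |r| + |z| <= |r| (1 + |z| / e); multiplying over the
    roots compares p(z) with p(0). *)
Lemma rootfree_growth (C : numClosedFieldType) (p : {poly C}) (d : nat) (e z : C) :
  0 < e -> (size p <= d)%N -> (forall s, `|s| < e -> p.[s] != 0) ->
  `|p.[z]| <= `|p.[0]| * (1 + `|z| / e) ^+ d.
Proof.
move=> e0 sz_p p_neq0; have [rs Dp] := closed_field_poly_normal p.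
have lc0 : lead_coef p != 0.
  rewrite lead_coef_eq0; apply: contraTneq (p_neq0 0 _) => [->|].
    by rewrite horner0 eqxx.
  by rewrite normr0.
have rs_le : (size rs <= d)%N.
  have sz : size p = (size rs).+1.
    by rewrite [in LHS]Dp size_scale // size_prod_XsubC.
  by apply: leq_trans sz_p; rewrite sz.
have rs_ge r : r \in rs -> e <= `|r|.
  move=> r_rs; rewrite real_leNgt ?normr_real ?gtr0_real //.
  apply/negP => /p_neq0; rewrite Dp hornerZ horner_prod.
  by rewrite (big_rem r) //= hornerXsubC subrr mul0r mulr0 eqxx.
have K1 : 1 <= 1 + `|z| / e by rewrite lerDl divr_ge0 // ltW.
apply: (@le_trans _ _ (`|p.[0]| * (1 + `|z| / e) ^+ size rs)); last first.
  by apply: ler_wpM2l => //; apply: ler_weXn2l.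
rewrite Dp !hornerZ !horner_prod !normrM -mulrA ler_wpM2l //.
elim: rs rs_ge {rs_le Dp} => [|r rs IHrs] rs_ge.
  by rewrite !big_nil normr1 mulr1.
rewrite !big_cons !normrM exprS mulrACA !hornerXsubC sub0r normrN.
rewrite ler_pM // ?IHrs // => [|s s_rs]; last by rewrite rs_ge // inE s_rs orbT.
rewrite (le_trans (ler_normB _ _)) // mulrDr mulr1 addrC lerD2l.
have er : e <= `|r| by rewrite rs_ge // mem_head.
by rewrite mulrCA ler_peMr // ler_pdivlMr // mul1r.
Qed.

Lemma size_sum_scale (K : nzRingType) (T : Type) (s : seq T) (c : T -> K)
    (q : T -> {poly K}) :
  (size (\sum_(i <- s) c i *: q i)%R <= \sum_(i <- s) size (q i))%N.
Proof.
elim/big_rec2: _ => [|i n p _ IH]; first by rewrite size_poly0.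
apply: leq_trans (size_polyD _ _) _; rewrite geq_max.
rewrite (leq_trans (size_scale_leq _ _)) ?leq_addr //.
exact: leq_trans IH (leq_addl _ _).
Qed.

Lemma ler_linear_bounded (R : realType) (x B : R[i]) :
  0 <= x -> 0 <= B -> (forall t : R, 0 < t -> t%:C * x <= B) -> x = 0.
Proof.
move=> x0 B0 xB; apply/eqP/contraT => nz_x.
have x_gt0 : 0 < x by rewrite lt_def nz_x.
have /complex_realP[t Dt] : B / x + 1 \is Num.real.
  by rewrite ger0_real // addr_ge0 // divr_ge0.
have t0 : 0 < t by rewrite -ltcR -Dt ltr_wpDl // divr_ge0.
have := xB t t0; rewrite -Dt mulrDl divfK // mul1r gerDl => le_x.
by rewrite lt_geF in le_x.
Qed.

(** This follows from 1 + u <= exp u. The explicit O(1/t) lets the limit below be taken with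
    [ler_linear_bounded]. *)
Lemma expR_decay (R : realType) (t d : R) :
  0 < t -> 0 < d -> t * expR (- (t * d)) <= d^-1.
Proof.
move=> t0 d0; have td0 : 0 < t * d by rewrite mulr_gt0.
rewrite expRN ler_pdivrMr ?expR_gt0 // ler_pdivlMl // mulrC.
by apply: le_trans (expR_ge1Dx _); rewrite lerDr.
Qed.

(* A polynomial of degree d without roots in the disc of radius e grows by a
   factor of at most (1 + |z| / e) ^ d between 0 and z; this bound is uniform in
   t and hence passes to the limit. *)
Lemma exp_sum_limit (R : realType) (T : eqType) (s : seq T) (w : T -> R)
    (q : T -> {poly R[i]}) (e : R[i]) :
  let top i := all (fun j => w j <= w i) s in
  0 < e ->
  (forall (t : R) z, 0 < t -> `|z| < e ->
     (\sum_(i <- s) (expR (t * w i))%:C *: q i).[z] != 0) ->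
  (\sum_(i <- s | top i) q i).[0] = 0 ->
  forall z, (\sum_(i <- s | top i) q i).[z] = 0.
Proof.
move=> top e0 rootfree G0 z.
have [/hasP[m ms /allP m_top] | /hasPn no_top] := boolP (has top s); last first.
  by rewrite big_seq_cond big1 ?horner0 // => i /andP[/no_top/negP].
set G := \sum_(i <- s | top i) q i in G0 *.
have topE i : i \in s -> top i -> w i = w m.
  by move=> si /allP iP; apply/eqP; rewrite eq_le m_top ?iP.
have ntop i : i \in s -> ~~ top i -> w i < w m.
  move=> si; apply: contraNT; rewrite -leNgt => le_mi.
  by apply/allP => j /m_top/le_trans; apply.
(* Coefficients after division by exp (t w_m): those of top weight become 1 and form the fixed part
   [G], the others form the remainder [E t]. *)
pose c t i : R := expR (- (t * (w m - w i))).
pose E t := \sum_(i <- s | ~~ top i) (c t i)%:C *: q i.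
have sumE t : \sum_(i <- s) (c t i)%:C *: q i = G + E t.
  rewrite (bigID top) /=; congr (_ + _).
  rewrite big_seq_cond [RHS]big_seq_cond; apply: eq_bigr => i /andP[si ti].
  by rewrite /c topE // subrr mulr0 oppr0 expR0 scale1r.
pose d := (\sum_(i <- s) size (q i))%N.
pose K := (1 + `|z| / e) ^+ d.
have K0 : 0 <= K by rewrite exprn_ge0 // addr_ge0 // divr_ge0 // ltW.
(* Since G(0) = 0, the value at 0 is that of the remainder alone, of order 1/t. *)
have growth t : 0 < t -> `|G.[z] + (E t).[z]| <= `|(E t).[0]| * K.
  move=> t0; have := @rootfree_growth _ (G + E t) d e z e0.
  rewrite !hornerD G0 add0r; apply; first by rewrite -sumE size_sum_scale.
  move=> y ye; have := rootfree t y t0 ye; rewrite -sumE !horner_sum.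
  apply: contraNneq => sum0; apply/eqP.
  transitivity ((expR (t * w m))%:C * \sum_(i <- s) ((c t i)%:C *: q i).[y]).
    rewrite mulr_sumr; apply: eq_bigr => i _.
    rewrite !hornerZ mulrA -rmorphM /= -expRD; congr (_%:C * _).
    by congr expR; ring.
  by rewrite sum0 mulr0.
(* By [expR_decay], [A y] bounds t |E_t(y)| for all t > 0. *)
pose A y : R[i] := \sum_(i <- s | ~~ top i) ((w m - w i)^-1)%:C * `|(q i).[y]|.
have A0 y : 0 <= A y.
  rewrite /A big_seq_cond sumr_ge0 // => i /andP[si /(ntop _ si) wi].
  by rewrite mulr_ge0 // ler0c invr_ge0 subr_ge0 ltW.
have EA t y : 0 < t -> t%:C * `|(E t).[y]| <= A y.
  move=> t0; rewrite /E horner_sum; have tC0 : 0 <= t%:C by rewrite ler0c ltW.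
  apply: le_trans (ler_wpM2l tC0 (ler_norm_sum _ _ _)) _.
  rewrite mulr_sumr big_seq_cond [leRHS]big_seq_cond.
  apply: ler_sum => i /andP[si /(ntop _ si) wi].
  rewrite hornerZ normrM mulrA ler_wpM2r // ger0_norm ?ler0c ?expR_ge0 //.
  by rewrite -rmorphM lecR expR_decay // subr_gt0.
apply/eqP; rewrite -normr_eq0; apply/eqP.
(* Here t |G(z)| <= t |G(z) + E_t(z)| + t |E_t(z)| <= A(0) K + A(z). *)
apply: (@ler_linear_bounded _ _ (A 0 * K + A z)) => // [|t t0].
  by rewrite addr_ge0 // mulr_ge0.
have tC0 : 0 <= t%:C by rewrite ler0c ltW.
rewrite -[G.[z]](addrK (E t).[z]).
apply: le_trans (ler_wpM2l tC0 (ler_normB _ _)) _.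
rewrite mulrDr lerD ?EA //; apply: le_trans (ler_wpM2l tC0 (growth t t0)) _.
by rewrite mulrA ler_wpM2r // EA.
Qed.

(** * Polynomials that vanish at every point *)

Lemma poly_eq0_of_horner (K : numDomainType) (p : {poly K}) :
  (forall x, p.[x] = 0) -> p = 0.
Proof.
move=> p0; apply: contraTeq isT => nz_p.
(* The naturals below [size p] are distinct in characteristic 0, and there is one more of them than
   the degree allows as roots. *)
pose rs : seq K := [seq k%:R | k <- iota 0 (size p)].
have roots_rs : all (root p) rs by apply/allP => x _; rewrite /root p0.
have uniq_rs : uniq rs.
  by rewrite map_inj_uniq ?iota_uniq // => a b /eqP; rewrite eqr_nat => /eqP.
by have := max_poly_roots nz_p roots_rs uniq_rs; rewrite size_map size_iota ltnn.
Qed.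

Lemma base_expansion_inj (B k : nat) (a b : 'I_k -> nat) :
  (forall i, a i < B)%N -> (forall i, b i < B)%N ->
  (\sum_(i < k) a i * B ^ i = \sum_(i < k) b i * B ^ i)%N -> a =1 b.
Proof.
elim: k a b => [a b _ _ _ [] // | k IHk a b ltaB ltbB].
have split_low (c : 'I_k.+1 -> nat) : (\sum_(i < k.+1) c i * B ^ i =
    (\sum_(i < k) c (lift ord0 i) * B ^ i) * B + c ord0)%N.
  rewrite big_ord_recl muln1 addnC; congr (_ + _)%N.
  by rewrite big_distrl; apply: eq_bigr => i _; rewrite /= expnS; lia.
rewrite !split_low => eq_sum.
have B0 : (0 < B)%N by apply: leq_ltn_trans (ltaB ord0).
have := congr1 (modn^~ B) eq_sum; rewrite /= !modnMDl !modn_small // => eq0.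
move: eq_sum; rewrite eq0 => /addIn/eqP; rewrite eqn_pmul2r // => /eqP eq_high.
move=> i; have [j ->|-> //] := unliftP ord0 i.
exact: (IHk (fun j => a (lift ord0 j)) (fun j => b (lift ord0 j))).
Qed.

(* Kronecker's substitution: along v_i = x ^ (B ^ i), with B larger than all
   exponents, distinct monomials become distinct powers of x. *)
Lemma mpoly_eq0_of_meval (K : numDomainType) (k : nat) (g : {mpoly K[k]}) :
  (forall v, g.@[v] = 0) -> g = 0.
Proof.
move=> g0; pose B := msize g.
pose kr (m : 'X_{1..k}) := (\sum_(i < k) m i * B ^ i)%N.
have kr_inj : {in msupp g &, injective kr}.
  have ltB m i : m \in msupp g -> (m i < B)%N.
    move=> /msize_mdeg_lt; apply: leq_ltn_trans.
    by rewrite mdegE (bigD1 i) //= leq_addr.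
  by move=> m1 m2 g1 g2 /base_expansion_inj eqm; apply/mnmP/eqm => i; apply: ltB.
pose q : {poly K} := \sum_(m <- msupp g) g@_m *: 'X^(kr m).
have q0 : q = 0.
  apply: poly_eq0_of_horner => x; rewrite -[RHS](g0 (fun i => x ^+ (B ^ i))).
  rewrite mevalE horner_sum; apply: eq_bigr => m _.
  rewrite hornerZ hornerXn /kr expr_sum; congr (_ * _).
  by apply: eq_bigr => i _; rewrite -exprM mulnC.
apply/mpolyP => m; rewrite mcoeff0; apply/eqP; rewrite mcoeff_eq0.
apply/negP => gm; have := gm; rewrite mcoeff_msupp => /eqP; apply.
have := congr1 (fun p : {poly K} => p`_(kr m)) q0.
rewrite coef0 coef_sum (bigD1_seq m) ?msupp_uniq //= big_seq_cond big1.
  by rewrite addr0 coefZ coefXn eqxx mulr1.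
move=> m' /andP[gm' nem]; rewrite coefZ coefXn.
by case: eqP => [/kr_inj eqm|]; rewrite ?mulr0 //; rewrite eqm ?eqxx in nem.
Qed.

(** * Initial forms *)

(** Any assignment of the variables is read off a symmetric matrix, so vanishing at all symmetric
    matrices is vanishing at all points. *)
Lemma sympoint_symvar (T : Type) n (v : 'I_#|symvar n| -> T) k :
  sympoint (\matrix_(i, j) v (zidx i j)) k = v k.
Proof.
rewrite /sympoint mxE /zidx; congr v; rewrite -[RHS]enum_valK; congr enum_rank.
by apply: val_inj; case: (enum_val k) => -[i j] /= ->.
Qed.

(** For i != j the entries at (i, j) and (j, i) each contribute half of the exponent; so each
    variable has weight w_ij, matching the scaling by exp (t w_ij). *)
Lemma frobenius_expmx (R : realType) n (W : 'M[R]_n) m : W^T = W ->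
  frobenius W (expmx R m) = \sum_k sympoint W k * (m k)%:R.
Proof.
move=> sW; rewrite /frobenius pair_big /=.
rewrite (bigID (fun p : 'I_n * 'I_n => p.1 <= p.2)%N) /=.
pose swap (p : 'I_n * 'I_n) := (p.2, p.1).
rewrite [X in _ + X](reindex_inj (h := swap)) /=; last first.
  by move=> [a b] [a' b'] [-> ->].
rewrite (bigID (fun p : 'I_n * 'I_n => p.1 == p.2)) /=.
pose F (p : 'I_n * 'I_n) : R := W p.1 p.2 * (m (zidx p.1 p.2))%:R.
transitivity (\sum_(p : 'I_n * 'I_n | (p.1 <= p.2)%N) F p).
  rewrite [RHS](bigID (fun p : 'I_n * 'I_n => p.1 == p.2)) /= -addrA.
  congr (_ + _); first by apply: eq_bigr => p /andP[_ pp]; rewrite mxE pp.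
  have off (p : 'I_n * 'I_n) :
      ~~ (p.2 <= p.1)%N = (p.1 <= p.2)%N && (p.1 != p.2).
    by rewrite -ltnNge ltn_neqAle andbC.
  rewrite [X in _ + X](eq_bigl _ _ off).
  rewrite -big_split; apply: eq_bigr => p /andP[_ pp] /=.
  rewrite !mxE (negbTE pp) eq_sym (negbTE pp) (zidxC p.2) /F.
  have -> : W p.2 p.1 = W p.1 p.2 by rewrite -[in LHS]sW mxE.
  by field.
rewrite [RHS](reindex (@enum_rank (symvar n))) /=; last first.
  by apply: onW_bij; exact: enum_rank_bij.
transitivity (\sum_(u : symvar n) F (val u)).
  exact: (big_sub [pred p : 'I_n * 'I_n | (p.1 <= p.2)%N]).
apply: eq_bigr => u _; rewrite /F /sympoint enum_rankK.
congr (_ * (m _)%:R); rewrite /zidx; congr enum_rank.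
by apply: val_inj; case: u => -[i j] /= ->.
Qed.

Lemma map_Im_line (R : realType) n (A B : 'M[R[i]]_n) z :
  map_mx (@complex.Im R) (A + z *: B) = map_mx (@complex.Im R) A +
    complex.Re z *: map_mx (@complex.Im R) B +
    complex.Im z *: map_mx (@complex.Re R) B.
Proof.
apply/matrixP => i j; rewrite !mxE.
by case: (A i j) (B i j) z => [a a'] [b b'] [c c'] /=; ring.
Qed.

Definition scale_entries (R : realType) n (A : 'M[R]_n) (M : 'M[R[i]]_n) :=
  \matrix_(i, j) ((expR (A i j))%:C * M i j).

Lemma sympoly_eval_scale (R : realType) n (f : sympoly R n) (W : 'M[R]_n) t M :
  W^T = W ->
  sympoly_eval f (scale_entries (t *: W) M) =
  \sum_(m <- msupp f) (expR (t * frobenius W (expmx R m)))%:C *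
    (f@_m * \prod_k sympoint M k ^+ m k).
Proof.
move=> sW; rewrite /sympoly_eval mevalE; apply: eq_bigr => m _.
rewrite mulrCA; congr (_ * _); rewrite frobenius_expmx // mulr_sumr expR_sum.
rewrite rmorph_prod -big_split /=; apply: eq_bigr => k _.
by rewrite {1}/sympoint !mxE exprMn mulrA expRM_natr rmorphXn.
Qed.

Lemma trmx_line (K : comNzRingType) n (A B : 'M[K]_n) z :
  A^T = A -> B^T = B -> (A + z *: B)^T = A + z *: B.
Proof.
move=> sA sB; apply/matrixP => i j.
by rewrite !mxE -[in LHS]sA -[in LHS]sB !mxE.
Qed.

Lemma scale_entries_tr (R : realType) n (A : 'M[R]_n) (M : 'M[R[i]]_n) :
  A^T = A -> M^T = M -> (scale_entries A M)^T = scale_entries A M.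
Proof.
move=> sA sM; apply/matrixP => i j.
by rewrite !mxE -[in LHS]sA -[in LHS]sM !mxE.
Qed.

Lemma scale_entries_Im (R : realType) n (A : 'M[R]_n) (M : 'M[R[i]]_n) :
  map_mx (@complex.Im R) (scale_entries A M) =
  \matrix_(i, j) (expR (A i j) * map_mx (@complex.Im R) M i j).
Proof.
apply/matrixP => i j; rewrite !mxE; case: (M i j) => a b /=.
by rewrite mul0r addr0.
Qed.

(** Restriction to the complex line M + z D makes the univariate growth bound applicable. *)
Definition line_monomial (R : realType) n (f : sympoly R n) (M D : 'M[R[i]]_n) m
    : {poly R[i]} :=
  f@_m *: \prod_k ((sympoint M k)%:P + sympoint D k *: 'X) ^+ m k.

Lemma line_monomialE (R : realType) n (f : sympoly R n) M D m z :
  (line_monomial f M D m).[z] = f@_m * \prod_k sympoint (M + z *: D) k ^+ m k.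
Proof.
rewrite hornerZ horner_prod; congr (_ * _); apply: eq_bigr => k _.
by rewrite !(horner_exp, hornerE) /sympoint !mxE [_ * z]mulrC.
Qed.

Lemma initial_form_eval (R : realType) n (f : sympoly R n) (W : 'M[R]_n) M :
  sympoly_eval (initial_form W f) M =
  \sum_(m <- msupp f | max_weight W f m) f@_m * \prod_k sympoint M k ^+ m k.
Proof.
rewrite /sympoly_eval /initial_form raddf_sum /=; apply: eq_bigr => m _.
by rewrite mevalZ mevalX.
Qed.

(** A finite nonempty support attains its maximal weight, and the coefficient of such a monomial
    survives in the initial form. *)
Lemma initial_form_neq0 (R : realType) n (f : sympoly R n) (W : 'M[R]_n) :
  f != 0 -> initial_form W f != 0.
Proof.
rewrite -msupp_eq0 => nz_f.
have [m fm m_max] : exists2 m, m \in msupp f & max_weight W f m.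
  rewrite /max_weight; elim: (msupp f) nz_f => // a s IHs _.
  have [-> | /IHs[b sb /allP b_max]] := eqVneq s [::].
    by exists a; rewrite ?mem_head //= lexx.
  have [le_ba|lt_ab] := lerP (frobenius W (expmx R b)) (frobenius W (expmx R a)).
    exists a; rewrite ?mem_head //= lexx; apply/allP => c /b_max le_cb.
    exact: le_trans le_ba.
  by exists b; rewrite ?inE ?sb ?orbT //= ltW //; apply/allP.
apply: contraTneq (fm) => g0; rewrite -mcoeff_eq0; apply/eqP.
have := congr1 (mcoeff m) g0; rewrite mcoeff0 => <-.
rewrite raddf_sum /= -big_filter (bigD1_seq m) ?filter_uniq ?msupp_uniq //=.
  rewrite big1 ?addr0 => [|m' /negbTE nem]; rewrite mcoeffZ mcoeffX ?nem ?mulr0 //.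
  by rewrite eqxx mulr1.
by rewrite mem_filter m_max.
Qed.

Theorem theorem4p10 (R : realType) (n : nat) (f : sympoly R n) (W : 'M[R]_n) :
  psd_stable f -> posdefmx W -> psd_stable (initial_form W f).
Proof.
move=> stable_f pdW M sM pdM; have [sW _] := pdW.
apply/eqP => gM0.
have nz_f : f != 0.
  by apply: contraTneq (stable_f M sM pdM) => ->; rewrite /sympoly_eval meval0 eqxx.
have /negP[] := initial_form_neq0 W nz_f; apply/eqP/mpoly_eq0_of_meval => v.
(* The line runs from [M] at z = 0 to the symmetric matrix of [v] at z = 1. *)
pose D := \matrix_(i, j) v (zidx i j) - M.
have sD : D^T = D by apply/matrixP => i j; rewrite !mxE zidxC -[in LHS]sM mxE.
have gE z : sympoly_eval (initial_form W f) (M + z *: D) =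
    (\sum_(m <- msupp f | max_weight W f m) line_monomial f M D m).[z].
  rewrite initial_form_eval horner_sum; apply: eq_bigr => m _.
  by rewrite line_monomialE.
have sReD : (map_mx (@complex.Re R) D)^T = map_mx (@complex.Re R) D.
  by rewrite matrix.map_trmx sD.
have sImD : (map_mx (@complex.Im R) D)^T = map_mx (@complex.Im R) D.
  by rewrite matrix.map_trmx sD.
have [e e0 pdMD] := posdefmx_open pdM sImD sReD.
have -> : (initial_form W f).@[v] = sympoly_eval (initial_form W f) (M + 1 *: D).
  apply: meval_eq => k; rewrite scale1r addrC subrK.
  by rewrite sympoint_symvar.
rewrite gE.
pose w m := frobenius W (expmx R m).
apply: (exp_sum_limit (e := e%:C) (w := w)).
- by rewrite ltcR.
- move=> t z t0 lt_ze; rewrite horner_sum.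
  suff -> : \sum_(m <- msupp f)
      ((expR (t * w m))%:C *: line_monomial f M D m).[z] =
      sympoly_eval f (scale_entries (t *: W) (M + z *: D)).
    apply: stable_f.
      apply: scale_entries_tr; last exact: trmx_line.
      by apply/matrixP => i j; rewrite !mxE -[in LHS]sW mxE.
    rewrite scale_entries_Im; apply: posdefmx_expR.
      exact: semidefiniteZ (ltW t0) (posdefmx_semidefinite pdW).
    (* Both |Re z| and |Im z| are at most |z|, hence below [e]. *)
    rewrite map_Im_line; apply: pdMD; rewrite -ltcR; apply: le_lt_trans lt_ze.
      exact: normc_ge_Re.
    by rewrite normc_def lecR -sqrtr_sqr ler_wsqrtr // lerDr sqr_ge0.
  rewrite sympoly_eval_scale //; apply: eq_bigr => m _.
  by rewrite hornerZ line_monomialE.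
- by rewrite -gE scale0r addr0.
Qed.
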